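(* For every integer $N \geq 4$, the set of typical coranks of $S = ([N]\times[N]) \setminus \{(1,1),(2,2),(3,3),(4,4)\}$ is exactly $\{1,2\}$. (In the paper's notation: $\mathrm{tc}(G(4,1)^{\mathsf c}) = \{1,2\}$.)
   Context: $[N] = \{1,\ldots,N\}$. For $S \subseteq [N]\times[N]$ (the specified entries), a partial filling is a point $A \in \mathbb{R}^S$. A real completion of $A$ is a matrix $M \in \mathbb{R}^{N\times N}$ with $M_{ij} = A_{ij}$ for all $(i,j)\in S$. An integer $r$ is a typical rank of $S$ if there is a nonempty Euclidean open subset of $\mathbb{R}^S$ such that for every $A$ in it, the minimum rank among all real completions of $A$ equals $r$. The typical coranks of $S$ are the numbers $N - r$ with $r$ a typical rank of $S$. For a finite set $U$ of unspecified entries, $\mathrm{tc}(U^{\mathsf c})$ denotes the set of typical coranks of $([N]\times[N])\setminus U$, for any $N$ with $U \subseteq [N]\times[N]$ (this does not depend on $N$). $G(4,1) = \{(i,i) : 1 \leq i \leq 4\}$. *)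

(* Defs.v *)
From mathcomp Require Import all_boot all_order all_algebra.
From mathcomp Require Import all_classical all_reals all_analysis.

Set Implicit Arguments.
Unset Strict Implicit.
Unset Printing Implicit Defensive.

Import Order.TTheory GRing.Theory Num.Theory.
Import numFieldNormedType.Exports.

Local Open Scope classical_set_scope.
Local Open Scope ring_scope.

(* A partial filling, i.e. a point of R^S, is encoded as a row vector whose
   coordinates are indexed by the enumeration of S: coordinate k is the value
   prescribed at the position [enum_val k].  The topology on R^S is that of
   the sup norm of row vectors, which is the Euclidean topology. *)
Definition filling (R : realType) (N : nat) (S : {set 'I_N * 'I_N}) :=
  'rV[R]_#|S|.

Definition completion (R : realType) (N : nat) (S : {set 'I_N * 'I_N})
    (A : filling R S) : set 'M[R]_N :=
  [set M | forall k : 'I_#|S|, M (enum_val k).1 (enum_val k).2 = A 0 k].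

Definition min_completion_rank (R : realType) (N : nat)
    (S : {set 'I_N * 'I_N}) (A : filling R S) (r : nat) : Prop :=
  (exists2 M, completion A M & \rank M = r) /\
  (forall M, completion A M -> (r <= \rank M)%N).

Definition typical_ranks (R : realType) (N : nat) (S : {set 'I_N * 'I_N}) :
    set nat :=
  [set r | exists O : set (filling R S),
     [/\ open O, O !=set0 & forall A, O A -> min_completion_rank A r]].

(* Truncated subtraction is harmless here: a typical rank is the rank of an
   N x N matrix, hence at most N. *)
Definition typical_coranks (R : realType) (N : nat) (S : {set 'I_N * 'I_N}) :
    set nat :=
  [set (N - r)%N | r in typical_ranks R S].

(* Positions are numbered from 0: the diagonal entries (1,1), ..., (g,g) of the
   mathematical text are the (i,i) with [i < g]. *)
Definition diag_positions (N g : nat) : {set 'I_N * 'I_N} :=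
  [set (i, i) | i : 'I_N & (i < g)%N].

(* Main.v *)
(* Put N = 4 + m and let G be the submatrix of rows 1, 2, 5, ..., N and columns
   3, 4, ..., N, which is fully specified.  When G is invertible, the rank of a
   completion is N - 2 plus the rank of the 2 x 2 Schur complement H of G, whose
   (i, j) entry has the form a_ij - w_ij x_j - y_i (k_ij x_j + v_ij), where
   x_1, x_2, y_1, y_2 are the four free entries and a, k, v, w are rational
   functions of the specified ones.  Eliminating y and x_2 from H = 0 leaves a
   quadratic equation in x_1.  Near a filling where its discriminant is negative
   H never vanishes, but its first column can be made zero, so the minimal rank
   is N - 1; near a filling where it has a simple real root the minimal rank is
   N - 2.  No other rank is typical, because G and the principal minor omitting
   the first row and column (for a suitable choice of the other free entries) are
   invertible for a dense set of fillings. *)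

Require Import Defs.
From mathcomp Require Import all_boot all_order all_algebra.
From mathcomp Require Import all_classical all_reals all_analysis.
From mathcomp Require Import zify ring lra.

Import Order.TTheory GRing.Theory Num.Theory.
Import numFieldNormedType.Exports.

Set Implicit Arguments.
Unset Strict Implicit.
Unset Printing Implicit Defensive.

Local Open Scope classical_set_scope.

(** * Rank of block matrices: Schur complements and exchange of row blocks *)

Section SchurComplement.
Local Open Scope ring_scope.
Variable F : fieldType.

(** Block Gaussian elimination: unipotent triangular factors on the left and right clear [Y] and [X]
    without changing the rank. *)
Lemma rank_block_mx_schur p q r (E : 'M[F]_(p, r)) (Y : 'M[F]_(p, q))
    (X : 'M[F]_(q, r)) (G : 'M[F]_q) : G \in unitmx ->
  \rank (block_mx E Y X G) = (q + \rank (E - Y *m invmx G *m X)%R)%N.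
Proof.
move=> uG.
pose U := block_mx (1%:M : 'M[F]_p) (Y *m invmx G) 0 (1%:M : 'M[F]_q).
pose L := block_mx (1%:M : 'M[F]_r) 0 (invmx G *m X) (1%:M : 'M[F]_q).
have -> : block_mx E Y X G
    = U *m block_mx (E - Y *m invmx G *m X) 0 0 G *m L.
  rewrite !mulmx_block !(mul1mx, mulmx1, mul0mx, mulmx0, addr0, add0r).
  by rewrite mulmxKV // mulKVmx // mulmxA subrK.
have uU : U \in unitmx by rewrite unitmxE det_ublock !det1 mulr1 unitr1.
have uL : L \in unitmx by rewrite unitmxE det_lblock !det1 mulr1 unitr1.
rewrite mxrankMfree ?row_free_unit // eqmxMfull ?row_full_unit //.
by rewrite rank_diag_block_mx (mxrank_unit uG) addnC.
Qed.

Lemma drsubmxDZ m1 m2 n1 n2 a (A B : 'M[F]_(m1 + m2, n1 + n2)) :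
  drsubmx (A + a *: B) = drsubmx A + a *: drsubmx B.
Proof. by apply/matrixP => i j; rewrite !mxE. Qed.

Definition swap_rows p q r n (M : 'M[F]_(p + (q + r), n)) :
    'M[F]_(q + (p + r), n) :=
  col_mx (usubmx (dsubmx M)) (col_mx (usubmx M) (dsubmx (dsubmx M))).

(** Stacking blocks corresponds to summing their row spaces, and this sum is associative and
    commutative. *)
Lemma rank_swap_rows p q r n (M : 'M[F]_(p + (q + r), n)) :
  \rank (swap_rows M) = \rank M.
Proof.
have col3 m1 m2 m3 (A : 'M[F]_(m1, n)) (B : 'M[F]_(m2, n)) (C : 'M[F]_(m3, n)) :
    \rank (col_mx A (col_mx B C)) = \rank (A + (B + C))%MS.
  by rewrite -addsmxE (adds_eqmx (eqmx_refl A) (eqmx_sym (addsmxE B C))).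
by rewrite col3 addsmxA (addsmxC (usubmx (dsubmx M))) -addsmxA -col3 !vsubmxK.
Qed.

Lemma swap_rowsDZ p q r n a (M M' : 'M[F]_(p + (q + r), n)) :
  swap_rows (M + a *: M') = swap_rows M + a *: swap_rows M'.
Proof. by rewrite /swap_rows !linearD !linearZ /= !scale_col_mx !add_col_mx. Qed.

Lemma swap_rows_block p q r a b c (A : 'M[F]_(p, a)) (B : 'M[F]_(p, b))
    (C : 'M[F]_(p, c)) (D : 'M[F]_(q, a)) (E : 'M[F]_(r, a)) (P : 'M[F]_(q, b))
    (Q : 'M[F]_(q, c)) (S : 'M[F]_(r, b)) (T : 'M[F]_(r, c)) :
  swap_rows (block_mx A (row_mx B C) (col_mx D E) (block_mx P Q S T)) =
  block_mx D (row_mx P Q) (col_mx A E) (block_mx B C S T).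
Proof.
rewrite /swap_rows block_mxEv col_mxKu col_mxKd (block_mxEv P) -block_mxEh.
rewrite (block_mxEv D) col_mxKu col_mxKd (block_mxEv _ _ (col_mx A E)).
by rewrite (block_mxEv B) -block_mxEh block_mxEv.
Qed.

Lemma swap_rows_diag p q r (x : 'rV[F]_p) (y : 'rV[F]_q) :
  swap_rows (diag_mx (row_mx x (row_mx y (0 : 'rV[F]_r)))) =
  block_mx 0 (row_mx (diag_mx y) 0) (col_mx (diag_mx x) 0) 0.
Proof.
by rewrite !diag_mx_row linear0 -row_mx0 -col_mx0 swap_rows_block block_mx0.
Qed.

End SchurComplement.

(** * Entrywise limits of matrix-valued functions along a filter *)

Section MatrixLimits.
Local Open Scope ring_scope.
Variables (R : realType) (T : Type) (F : set_system T).
Context {FF : Filter F}.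

Definition mx_cvg m n (f : T -> 'M[R]_(m, n)) (A : 'M[R]_(m, n)) :=
  forall i j, (fun x => f x i j) @ F --> A i j.

Lemma cvg_rsum (I : Type) (r : seq I) (P : pred I) (f : I -> T -> R)
    (a : I -> R) :
  (forall i, f i @ F --> a i) ->
  (fun x => \sum_(i <- r | P i) f i x) @ F --> \sum_(i <- r | P i) a i.
Proof. by move=> fa; apply: cvg_big => [|i _]; [exact: add_continuous|exact: fa]. Qed.

Lemma cvg_rprod (I : Type) (r : seq I) (P : pred I) (f : I -> T -> R)
    (a : I -> R) :
  (forall i, f i @ F --> a i) ->
  (fun x => \prod_(i <- r | P i) f i x) @ F --> \prod_(i <- r | P i) a i.
Proof. by move=> fa; apply: cvg_big => [|i _]; [exact: mul_continuous|exact: fa]. Qed.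

Lemma mx_cvg_cst m n (A : 'M[R]_(m, n)) : mx_cvg (fun=> A) A.
Proof. by move=> i j; exact: cvg_cst. Qed.

Lemma mx_cvgB m n (f g : T -> 'M[R]_(m, n)) A B :
  mx_cvg f A -> mx_cvg g B -> mx_cvg (fun x => f x - g x) (A - B).
Proof.
move=> fA gB i j; rewrite !mxE; under eq_cvg do rewrite !mxE.
by apply: cvgB; [exact: fA|exact: gB].
Qed.

Lemma mx_cvgM m n p (f : T -> 'M[R]_(m, n)) (g : T -> 'M[R]_(n, p)) A B :
  mx_cvg f A -> mx_cvg g B -> mx_cvg (fun x => f x *m g x) (A *m B).
Proof.
move=> fA gB i j; rewrite !mxE; under eq_cvg do rewrite !mxE.
by apply: cvg_rsum => k; apply: cvgM; [exact: fA|exact: gB].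
Qed.

Lemma mx_cvg_col m1 m2 n (f : T -> 'M[R]_(m1, n)) (g : T -> 'M[R]_(m2, n)) A B :
  mx_cvg f A -> mx_cvg g B -> mx_cvg (fun x => col_mx (f x) (g x)) (col_mx A B).
Proof.
move=> fA gB i j; rewrite mxE; under eq_cvg do rewrite mxE.
by case: (fintype.split i) => k; [exact: fA|exact: gB].
Qed.

Lemma mx_cvg_usub m1 m2 n (f : T -> 'M[R]_(m1 + m2, n)) A :
  mx_cvg f A -> mx_cvg (fun x => usubmx (f x)) (usubmx A).
Proof. by move=> fA i j; rewrite mxE; under eq_cvg do rewrite mxE; exact: fA. Qed.

Lemma mx_cvg_dsub m1 m2 n (f : T -> 'M[R]_(m1 + m2, n)) A :
  mx_cvg f A -> mx_cvg (fun x => dsubmx (f x)) (dsubmx A).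
Proof. by move=> fA i j; rewrite mxE; under eq_cvg do rewrite mxE; exact: fA. Qed.

Lemma mx_cvg_lsub m n1 n2 (f : T -> 'M[R]_(m, n1 + n2)) A :
  mx_cvg f A -> mx_cvg (fun x => lsubmx (f x)) (lsubmx A).
Proof. by move=> fA i j; rewrite mxE; under eq_cvg do rewrite mxE; exact: fA. Qed.

Lemma mx_cvg_rsub m n1 n2 (f : T -> 'M[R]_(m, n1 + n2)) A :
  mx_cvg f A -> mx_cvg (fun x => rsubmx (f x)) (rsubmx A).
Proof. by move=> fA i j; rewrite mxE; under eq_cvg do rewrite mxE; exact: fA. Qed.

Lemma cvg_det n (f : T -> 'M[R]_n) A :
  mx_cvg f A -> (fun x => \det (f x)) @ F --> \det A.
Proof.
move=> fA; apply: cvg_rsum => s.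
by apply: cvgM; [exact: cvg_cst|apply: cvg_rprod => i; exact: fA].
Qed.

Lemma mx_cvg_adj n (f : T -> 'M[R]_n) A :
  mx_cvg f A -> mx_cvg (fun x => \adj (f x)) (\adj A).
Proof.
move=> fA i j; rewrite !mxE; under eq_cvg do rewrite !mxE.
apply: cvgM; first exact: cvg_cst.
apply: cvg_det => k l; rewrite !mxE; under eq_cvg do rewrite !mxE.
exact: fA.
Qed.

Lemma near_unitmx n (f : T -> 'M[R]_n) A : A \in unitmx -> mx_cvg f A ->
  \forall x \near F, f x \in unitmx.
Proof.
rewrite unitmxE unitfE => dA /cvg_det /(cvgr_neq0 _) /(_ dA).
by apply: filterS => x; rewrite unitmxE unitfE.
Qed.

Lemma mx_cvg_inv n (f : T -> 'M[R]_n) A : A \in unitmx -> mx_cvg f A ->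
  mx_cvg (fun x => invmx (f x)) (invmx A).
Proof.
move=> uA fA i j.
have cvgV : (fun x => ((\det (f x))^-1 *: \adj (f x)) i j) @ F --> invmx A i j.
  rewrite /invmx uA mxE; under eq_cvg do rewrite mxE.
  apply: cvgM; last exact: mx_cvg_adj.
  by apply: cvgV; [rewrite -unitfE -unitmxE|exact: cvg_det].
(* [invmx] is given by the adjugate formula only on invertible matrices, so the two functions are
   compared only near the limit. *)
apply: cvg_trans cvgV; apply: near_eq_cvg.
by apply: filterS (near_unitmx uA fA) => x ux; rewrite /invmx ux.
Qed.

End MatrixLimits.

(** * The 2 x 2 Schur complement as a system of equations in the four free entries *)

Section TwoByTwo.
Local Open Scope ring_scope.
Variable R : realType.

Definition bilinear_residual (al ka v w : 'M[R]_2) (x y : 'rV[R]_2) : 'M[R]_2 :=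
  al - diag_mx y *m v - w *m diag_mx x - diag_mx y *m ka *m diag_mx x.

Lemma bilinear_residualE al ka v w x y i j :
  bilinear_residual al ka v w x y i j =
  al i j - w i j * x 0 j - y 0 i * (ka i j * x 0 j + v i j).
Proof.
rewrite /bilinear_residual mul_mx_diag !mul_diag_mx mul_mx_diag !mxE.
by ring.
Qed.

(** Here [K] stands for the inverse of the specified block. The free entries occupy only the first
    two columns of the left factor and the first two rows of the right one, so they meet only the
    matching corners of [K], [K *m X] and [Y *m K]. *)
Lemma schur_bilinear_residual m (E : 'M[R]_2) (Y : 'M[R]_(2, 2 + m))
    (X : 'M[R]_(2 + m, 2)) (K : 'M[R]_(2 + m)) (x y : 'rV[R]_2) :
  E - (Y + row_mx (diag_mx y) 0) *m K *m (X + col_mx (diag_mx x) 0) =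
  bilinear_residual (E - Y *m K *m X) (ulsubmx K) (usubmx (K *m X))
    (lsubmx (Y *m K)) x y.
Proof.
have rowM n (A : 'M[R]_(2 + m, n)) :
    row_mx (diag_mx y) 0 *m A = diag_mx y *m usubmx A.
  by rewrite -{1}(vsubmxK A) mul_row_col mul0mx addr0.
have colM n (A : 'M[R]_(n, 2 + m)) :
    A *m col_mx (diag_mx x) 0 = lsubmx A *m diag_mx x.
  by rewrite -{1}(hsubmxK A) mul_row_col mulmx0 addr0.
rewrite !(mulmxDl, mulmxDr) !rowM !colM.
rewrite -mulmx_lsub -(mulmxA (diag_mx y)) mul_usub_mx.
by rewrite /bilinear_residual /ulsubmx !opprD !addrA !mulmx_lsub.
Qed.

(* Eliminating [y 0 i] from the two equations of row [i] leaves
   [elim_slope i (x 0 0) * x 0 1 + elim_const i (x 0 0) = 0], and eliminating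
   [x 0 1] from these leaves the quadratic equation [elim_quad (x 0 0) = 0]. *)
Definition elim_slope (al ka v w : 'M[R]_2) i t :=
  (w i 1 * ka i 0 - w i 0 * ka i 1) * t + (al i 0 * ka i 1 + w i 1 * v i 0).
Definition elim_const (al ka v w : 'M[R]_2) i t :=
  (al i 0 * v i 1 - al i 1 * v i 0) - (w i 0 * v i 1 + al i 1 * ka i 0) * t.
Definition elim_quad (al ka v w : 'M[R]_2) t :=
  elim_slope al ka v w 0 t * elim_const al ka v w 1 t
  - elim_slope al ka v w 1 t * elim_const al ka v w 0 t.

(* A positive multiple of minus the discriminant of the quadratic polynomial
   [elim_quad], written through its values at [-1], [0] and [1]. *)
Definition elim_disc (al ka v w : 'M[R]_2) :=
  let q := elim_quad al ka v w in
  8 * q 0 * (q 1 + q (-1) - 2 * q 0) - (q 1 - q (-1)) * (q 1 - q (-1)).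

Section Limits.
Variables (T : Type) (F : set_system T).
Context {FF : Filter F}.
Variables (al ka v w : T -> 'M[R]_2) (al0 ka0 v0 w0 : 'M[R]_2) (t : T -> R) (t0 : R).
Hypotheses (al_cvg : mx_cvg F al al0) (ka_cvg : mx_cvg F ka ka0)
  (v_cvg : mx_cvg F v v0) (w_cvg : mx_cvg F w w0) (t_cvg : t @ F --> t0).

Lemma cvg_elim_slope i :
  (fun x => elim_slope (al x) (ka x) (v x) (w x) i (t x)) @ F -->
  elim_slope al0 ka0 v0 w0 i t0.
Proof.
by apply: cvgD; [apply: cvgM => //; apply: cvgB; apply: cvgM
                |apply: cvgD; apply: cvgM].
Qed.

Lemma cvg_elim_const i :
  (fun x => elim_const (al x) (ka x) (v x) (w x) i (t x)) @ F -->
  elim_const al0 ka0 v0 w0 i t0.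
Proof.
by apply: cvgB; [apply: cvgB; apply: cvgM
                |apply: cvgM => //; apply: cvgD; apply: cvgM].
Qed.

Lemma cvg_elim_quad :
  (fun x => elim_quad (al x) (ka x) (v x) (w x) (t x)) @ F -->
  elim_quad al0 ka0 v0 w0 t0.
Proof.
by apply: cvgB; apply: cvgM;
   [exact: cvg_elim_slope|exact: cvg_elim_const
   |exact: cvg_elim_slope|exact: cvg_elim_const].
Qed.

End Limits.

Lemma cvg_elim_disc (T : Type) (F : set_system T) {FF : Filter F}
    (al ka v w : T -> 'M[R]_2) (al0 ka0 v0 w0 : 'M[R]_2) :
  mx_cvg F al al0 -> mx_cvg F ka ka0 -> mx_cvg F v v0 -> mx_cvg F w w0 ->
  (fun x => elim_disc (al x) (ka x) (v x) (w x)) @ F --> elim_disc al0 ka0 v0 w0.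
Proof.
move=> al_cvg ka_cvg v_cvg w_cvg.
have qc t : (fun x => elim_quad (al x) (ka x) (v x) (w x) t) @ F -->
    elim_quad al0 ka0 v0 w0 t by apply: cvg_elim_quad => //; exact: cvg_cst.
apply: cvgB; apply: cvgM.
- by apply: cvgM; [exact: cvg_cst|exact: qc].
- apply: cvgB; first by apply: cvgD; exact: qc.
  by apply: cvgM; [exact: cvg_cst|exact: qc].
- by apply: cvgB; exact: qc.
- by apply: cvgB; exact: qc.
Qed.

Section Elimination.
Variables al ka v w : 'M[R]_2.
Local Notation elim_slope := (elim_slope al ka v w).
Local Notation elim_const := (elim_const al ka v w).
Local Notation elim_quad := (elim_quad al ka v w).

Lemma elim_quad_root x y :
  bilinear_residual al ka v w x y = 0 -> elim_quad (x 0 0) = 0.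
Proof.
move=> /matrixP res0.
have eq i j : y 0 i * (ka i j * x 0 j + v i j) = al i j - w i j * x 0 j.
  by apply/esym/eqP; rewrite -subr_eq0 -bilinear_residualE res0 mxE.
(* Cross-multiplying the two equations of row [i] eliminates [y 0 i] without any division. *)
have cross i : elim_slope i (x 0 0) * x 0 1 + elim_const i (x 0 0) = 0.
  have : (al i 0 - w i 0 * x 0 0) * (ka i 1 * x 0 1 + v i 1) =
         (al i 1 - w i 1 * x 0 1) * (ka i 0 * x 0 0 + v i 0).
    by rewrite -!eq; ring.
  by move/eqP; rewrite -subr_eq0 => /eqP <-; rewrite /elim_slope /elim_const; ring.
(* The quadratic is the determinant of two affine equations in [x 0 1], hence a combination of
   them. *)
have -> : elim_quad (x 0 0) =
    elim_slope 0 (x 0 0) * (elim_slope 1 (x 0 0) * x 0 1 + elim_const 1 (x 0 0))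
  - elim_slope 1 (x 0 0) * (elim_slope 0 (x 0 0) * x 0 1 + elim_const 0 (x 0 0)).
  by rewrite /elim_quad; ring.
by rewrite !cross !mulr0 subrr.
Qed.

(** At a real root, the discriminant of a quadratic is the square of its derivative there, hence
    nonnegative; [elim_disc] has the opposite sign. *)
Lemma residual_neq0 :
  0 < elim_disc al ka v w -> forall x y, bilinear_residual al ka v w x y != 0.
Proof.
move=> disc x y; apply/eqP => /elim_quad_root; set t := x 0 0.
rewrite /elim_disc subr_gt0 -expr2 in disc.
set a := elim_quad 1 in disc *; set b := elim_quad (-1) in disc *.
set c := elim_quad 0 in disc *.
(* Lagrange interpolation at [-1], [0] and [1]. *)
have -> : elim_quad t = (a + b - 2 * c) / 2 * t ^+ 2 + (a - b) / 2 * t + c.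
  by rewrite /a /b /c /elim_quad /elim_slope /elim_const; field.
move=> root.
(* The squared quantity is twice the derivative of [elim_quad] at [t]. *)
have : 0 <= ((a + b - 2 * c) * 2 * t + (a - b)) ^+ 2 by exact: sqr_ge0.
have -> : ((a + b - 2 * c) * 2 * t + (a - b)) ^+ 2 =
  8 * (a + b - 2 * c) * ((a + b - 2 * c) / 2 * t ^+ 2 + (a - b) / 2 * t + c)
  + ((a - b) ^+ 2 - 8 * c * (a + b - 2 * c)) by field.
by rewrite root mulr0 add0r subr_ge0 leNgt disc.
Qed.

(** Elimination run backwards: the intermediate value theorem gives [x 0 0], the affine equation of
    row 0 gives [x 0 1], and column 0 gives [y]. The divisors must be nonzero on the whole interval
    because the root is not located more precisely. *)
Lemma residual_solvable lo hi : lo <= hi ->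
  elim_quad lo < 0 < elim_quad hi ->
  (forall t, t \in `[lo, hi] ->
    [/\ elim_slope 0 t != 0, ka 0 0 * t + v 0 0 != 0
      & ka 1 0 * t + v 1 0 != 0]) ->
  exists x y, bilinear_residual al ka v w x y = 0.
Proof.
move=> lohi /andP[qlo qhi] nz.
have [t tin root] : exists2 t, t \in `[lo, hi] & elim_quad t = 0.
  apply: IVT => //; last first.
    by rewrite ge_min le_max (ltW qlo) (ltW qhi) orbT.
  apply: continuous_subspaceT => u.
  by apply: cvg_elim_quad => //; exact: mx_cvg_cst.
have [sl0 k0 k1] := nz t tin.
pose s := - elim_const 0 t / elim_slope 0 t.
pose x := \row_(j < 2) if j == 0 then t else s.
pose y := \row_i ((al i 0 - w i 0 * t) / (ka i 0 * t + v i 0)).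
exists x, y; apply/matrixP => i j; rewrite bilinear_residualE mxE.
have k i' : ka i' 0 * t + v i' 0 != 0.
  by case: i' => -[|[|//]] i2; [move: k0|move: k1];
     congr (ka _ _ * _ + v _ _ != 0); apply: val_inj.
have cross : elim_slope i t * s + elim_const i t = 0.
  have cross0 : elim_slope 0 t * s + elim_const 0 t = 0.
    by rewrite /s; field.
  case: i => -[|[|//]] i2.
    rewrite -[RHS]cross0.
    by congr (elim_slope _ _ * _ + elim_const _ _); apply: val_inj.
  rewrite (_ : Ordinal i2 = 1); last exact: val_inj.
  (* After multiplication by the nonzero slope of row 0, the equation of row 1 follows from that of
     row 0 and the vanishing of the quadratic. *)
  apply: (mulfI sl0); rewrite mulr0 -root /elim_quad.
  move/eqP: cross0; rewrite addr_eq0 => /eqP cross0.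
  by rewrite mulrDr mulrCA cross0; ring.
have yi : y 0 i = (al i 0 - w i 0 * t) / (ka i 0 * t + v i 0) by rewrite mxE.
have [->|->] : j = 0 \/ j = 1.
- by case: j => -[|[|//]] j2; [left|right]; apply: val_inj.
- by rewrite yi !mxE /=; field.
(* In column 1, clearing the denominator of [y 0 i] turns the residual into minus the left side of
   [cross]. *)
rewrite yi !mxE /=; apply: (mulfI (k i)); rewrite mulr0 -[RHS]oppr0 -cross.
by rewrite /elim_slope /elim_const; field.
Qed.

(** With [x] fixed at [(1, 1)], column 0 is affine in [y] and can be solved row by row; only one
    column is then left. *)
Lemma residual_col0_solvable :
  ka 0 0 + v 0 0 != 0 -> ka 1 0 + v 1 0 != 0 ->
  exists x y, (\rank (bilinear_residual al ka v w x y) <= 1)%N.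
Proof.
move=> k0 k1.
pose y := \row_i ((al i 0 - w i 0) / (ka i 0 + v i 0)).
exists (const_mx 1), y; set H := bilinear_residual _ _ _ _ _ _.
have H0 i : H i 0 = 0.
  have k : ka i 0 + v i 0 != 0.
    by case: i => -[|[|//]] i2; [move: k0|move: k1];
       congr (ka _ _ + v _ _ != 0); apply: val_inj.
  by rewrite bilinear_residualE !mxE; field.
have left0 : lsubmx (H : 'M[R]_(2, 1 + 1)) = 0.
  apply/matrixP => i j; rewrite mxE [RHS]mxE -[RHS](H0 i).
  by congr (H i _); apply: val_inj; case: j => -[].
have rank1 (B : 'M[R]_(2, 1)) : (\rank (row_mx (0 : 'M[R]_(2, 1)) B) <= 1)%N.
  by rewrite rank_row_0mx rank_leq_col.
by rewrite -[H](@hsubmxK R 2 1 1) left0; exact: rank1.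
Qed.

End Elimination.
End TwoByTwo.

(** * Zero extension of fillings, and generic invertibility along lines *)

Section Fillings.
Local Open Scope ring_scope.
Variable R : realType.

Section Fill.
Variables (N : nat) (S : {set 'I_N * 'I_N}).

(** The sum has at most one term; this form makes the extension by zero visibly linear and
    continuous in [A]. *)
Definition fill_zero (A : filling R S) : 'M[R]_N :=
  \matrix_(i, j) \sum_(k < #|S| | enum_val k == (i, j)) A 0 k.

Definition restrict_mx (M : 'M[R]_N) : filling R S :=
  \row_k M (enum_val k).1 (enum_val k).2.

Lemma fill_zero_val A k :
  fill_zero A (enum_val k).1 (enum_val k).2 = A 0 k.
Proof.
rewrite mxE (big_pred1 k) // => l.
by rewrite -surjective_pairing (inj_eq enum_val_inj).
Qed.

Lemma fill_zero_out A i j : (i, j) \notin S -> fill_zero A i j = 0.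
Proof.
by move=> ijS; rewrite mxE big1 // => k /eqP kij; rewrite -kij enum_valP in ijS.
Qed.

Lemma completionP A M :
  completion A M <-> forall i j, (i, j) \in S -> M i j = fill_zero A i j.
Proof.
split=> [AM i j ijS|MA k].
  by have := AM (enum_rank_in ijS (i, j)); rewrite -fill_zero_val enum_rankK_in.
by rewrite MA ?fill_zero_val // -surjective_pairing enum_valP.
Qed.

Lemma fill_restrict M i j : (i, j) \in S -> fill_zero (restrict_mx M) i j = M i j.
Proof.
have /completionP/(_ i j) MM : completion (restrict_mx M) M by move=> k; rewrite mxE.
by move=> /MM.
Qed.

Lemma fill_zeroDZ A B t :
  fill_zero (A + t *: B) = fill_zero A + t *: fill_zero B.
Proof.
apply/matrixP => i j; rewrite !mxE mulr_sumr -big_split /=.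
by apply: eq_bigr => k _; rewrite !mxE.
Qed.

Lemma cvg_fill_zero (A : filling R S) : mx_cvg (nbhs A) fill_zero (fill_zero A).
Proof.
move=> i j; rewrite mxE; under eq_cvg do rewrite mxE.
by apply: cvg_rsum => k; exact: (@coord_continuous R 1 #|S| 0 k A).
Qed.

Lemma near_line (A B : filling R S) (P : set (filling R S)) :
  nbhs A P -> \forall t \near (0 : R), P (A + t *: B).
Proof.
move=> AP; have : A + t *: B @[t --> (0 : R)] --> A.
  rewrite -[X in _ --> X]addr0 -(scale0r B).
  by apply: cvgD; [exact: cvg_cst|apply: cvgZr_tmp; exact: cvg_id].
exact.
Qed.

Lemma typical_rank_near (A : filling R S) r :
  (\forall B \near A, min_completion_rank B r) -> typical_ranks R S r.
Proof.
move=> near_r; exists (interior [set B | min_completion_rank B r]); split.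
- exact: open_interior.
- by exists A.
- exact: interior_subset.
Qed.

End Fill.

(** A nonzero polynomial has fewer than [size p] roots, so one of [size p] distinct points of the
    ball is not a root. *)
Lemma exists_near_nonroot (P : set R) (p : {poly R}) :
  nbhs 0 P -> p != 0 -> exists2 t, P t & ~~ root p t.
Proof.
move=> /nbhs_ballP[e /= e0 eP] p0.
(* Denominators start at 2 to stay strictly inside the ball of radius [e]. *)
pose s := [seq e / k.+2%:R | k <- iota 0 (size p)].
have us : uniq s.
  rewrite map_inj_uniq ?iota_uniq // => k l /(mulfI (lt0r_neq0 e0)) /invr_inj.
  by move=> /eqP; rewrite eqr_nat => /eqP [].
have /allPn[t /mapP[k _ ->] nr] : ~~ all (root p) s.
  apply/negP => /(max_poly_roots p0) /(_ us).
  by rewrite size_map size_iota ltnn.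
exists (e / k.+2%:R) => //; apply: eP.
rewrite /ball /= sub0r normrN gtr0_norm ?divr_gt0 ?ltr0n //.
by rewrite ltr_pdivrMr ?ltr0n // ltr_pMr // ltr1n.
Qed.

(** The determinant of [B + t%:M] is the characteristic polynomial of [- B] at [t]. *)
Lemma exists_near_unitmx n (B : 'M[R]_n) (P : set R) :
  nbhs 0 P -> exists2 t, P t & B + t%:M \in unitmx.
Proof.
move=> P0; have p0 : char_poly (- B) != 0 by rewrite -size_poly_eq0 size_char_poly.
have [t Pt nroot] := exists_near_nonroot P0 p0.
exists t => //; rewrite unitmxE unitfE; apply: contra nroot => /eqP dB.
rewrite /root -dB -horner_evalE -det_map_mx; apply/eqP; congr (\det _).
apply/matrixP => i j; rewrite !mxE /= /horner_eval.
by rewrite hornerD hornerN hornerC hornerMn hornerX opprK addrC.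
Qed.

End Fillings.

(** * Fillings with four missing diagonal entries, and the base fillings *)

Section MissingDiagonal.
Local Open Scope ring_scope.
Variables (R : realType) (m : nat).
Local Notation N := (2 + (2 + m))%N.
Local Notation S := (~: diag_positions N 4)%SET.
Local Notation fill := (@fill_zero R N S).

Lemma mem_specified (i j : 'I_N) :
  ((i, j) \in S) = ~~ ((i == j) && (i < 4)%N).
Proof.
rewrite inE; congr (~~ _); apply/imsetP/andP => [[k kin [-> ->]]|[/eqP <- i4]].
  by move: kin; rewrite inE eqxx; split.
by exists i; rewrite ?inE.
Qed.

Definition free_diag (x y : 'rV[R]_2) : 'M[R]_N :=
  diag_mx (row_mx x (row_mx y 0)).

Lemma completion_free_diagP (A : filling R S) M :
  completion A M <-> exists x y, M = fill A + free_diag x y.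
Proof.
rewrite completionP; split=> [MA|[x [y ->]] i j]; last first.
  rewrite mem_specified mxE => ijS; rewrite [X in _ + X]mxE.
  case: eqP ijS => [->|]; last by rewrite mulr0n addr0.
  rewrite -leqNgt mulr1n => j4; rewrite (_ : row_mx x _ 0 j = 0) ?addr0 // mxE.
  case: splitP => k jk; first by rewrite jk leqNgt (leq_trans (ltn_ord k)) in j4.
  rewrite mxE; case: splitP => l kl; last by rewrite mxE.
  by rewrite jk kl leqNgt ltn_add2l (ltn_ord l) in j4.
(* [fill A] vanishes at the free positions, so [d] carries the whole entry of [M] there and nothing
   elsewhere. *)
pose d : 'rV[R]_N := \row_j (M j j *+ (j < 4)%N).
have Md : M = fill A + diag_mx d.
  apply/matrixP => i j; rewrite mxE.
  have -> : diag_mx d i j = M i i *+ ((i == j) && (i < 4)%N).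
    by rewrite !mxE -mulrnA mulnb andbC.
  have [ijS|ijS] := boolP ((i, j) \in S).
    rewrite MA //; move: ijS; rewrite mem_specified => /negPf ->.
    by rewrite mulr0n addr0.
  rewrite fill_zero_out //; move: ijS; rewrite mem_specified negbK => ij.
  by rewrite ij add0r mulr1n; case/andP: ij => /eqP ->.
exists (lsubmx d), (lsubmx (rsubmx d)); rewrite Md /free_diag.
rewrite (_ : 0 = rsubmx (rsubmx d)) ?hsubmxK //.
by apply/matrixP => i j; rewrite !mxE.
Qed.

(* After the exchange of the two pairs of rows, the free entries of a completion
   lie in the blocks [ursubmx] and [dlsubmx], and [drsubmx] is fully specified. *)
Definition shuffle (A : filling R S) : 'M[R]_N := @swap_rows R 2 2 m N (fill A).

Definition al_of (B : 'M[R]_N) : 'M[R]_2 :=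
  ulsubmx B - ursubmx B *m invmx (drsubmx B) *m dlsubmx B.
Definition ka_of (B : 'M[R]_N) : 'M[R]_2 := ulsubmx (invmx (drsubmx B)).
Definition v_of (B : 'M[R]_N) : 'M[R]_2 :=
  usubmx (invmx (drsubmx B) *m dlsubmx B).
Definition w_of (B : 'M[R]_N) : 'M[R]_2 :=
  lsubmx (ursubmx B *m invmx (drsubmx B)).

Lemma rank_fill A x y : drsubmx (shuffle A) \in unitmx ->
  \rank (fill A + free_diag x y)%R =
  (2 + m + \rank (bilinear_residual (al_of (shuffle A)) (ka_of (shuffle A))
                    (v_of (shuffle A)) (w_of (shuffle A)) x y))%N.
Proof.
move=> uG; rewrite -(@rank_swap_rows _ 2 2 m) -(scale1r (free_diag x y)).
rewrite swap_rowsDZ scale1r swap_rows_diag -/(shuffle A).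
rewrite -{1}(submxK (shuffle A)) add_block_mx !addr0 rank_block_mx_schur //.
by rewrite schur_bilinear_residual.
Qed.

Lemma rank_completion_ge A M : drsubmx (shuffle A) \in unitmx ->
  completion A M -> (2 + m <= \rank M)%N.
Proof.
by move=> uG /completion_free_diagP[x [y ->]]; rewrite rank_fill // leq_addr.
Qed.

Definition swap2 : 'M[R]_2 := \matrix_(i, j) (i != j)%:R.

Lemma swap2_sqr : swap2 *m swap2 = 1%:M.
Proof.
apply/matrixP => i j; rewrite !mxE !big_ord_recl big_ord0 !mxE addr0.
by case: i => -[|[|//]] ?; case: j => -[|[|//]] ? /=;
   rewrite !(mulr0, mulr1, addr0, add0r).
Qed.

(* Shuffled, this is [block_mx E (row_mx swap2 0) (col_mx swap2 0) 1%:M] with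
   [E = 1 + u + e * swap2]. *)
Definition base_mx (u e : R) : 'M[R]_N :=
  block_mx swap2 (row_mx 1%:M 0) (col_mx (1%:M + (u%:M + e *: swap2)) 0)
    (block_mx swap2 0 0 1%:M).
Definition base u e : filling R S := @restrict_mx R N S (base_mx u e).

(** The four free positions lie on the diagonals of the two [swap2] blocks, which are zero, so
    extension by zero loses nothing. *)
Lemma fill_base u e : fill (base u e) = base_mx u e.
Proof.
apply/matrixP => i j; have [ijS|ijS] := boolP ((i, j) \in S).
  by rewrite fill_restrict.
rewrite fill_zero_out //; move: ijS; rewrite mem_specified negbK => /andP[/eqP <-].
rewrite !mxE; case: splitP => k ik; rewrite !mxE;
  case: splitP => l ik'; rewrite !mxE.
- have -> : k = l by apply: val_inj; rewrite /= -ik -ik'.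
  by rewrite eqxx.
- by have := ltn_ord k; rewrite -ik ik'.
- by have := ltn_ord l; rewrite -ik' ik.
have -> : k = l by apply: val_inj; apply: (@addnI 2); rewrite -ik -ik'.
case: splitP => k' lk; rewrite !mxE; case: splitP => l' lk'; rewrite !mxE.
- have -> : k' = l' by apply: val_inj; rewrite /= -lk -lk'.
  by rewrite eqxx.
- by have := ltn_ord k'; rewrite -lk lk'.
- by have := ltn_ord l'; rewrite -lk' lk.
by rewrite ik' lk'.
Qed.

Lemma shuffle_base u e : shuffle (base u e) =
  block_mx (1%:M + (u%:M + e *: swap2)) (row_mx swap2 0) (col_mx swap2 0) 1%:M.
Proof.
by rewrite /shuffle fill_base swap_rows_block -scalar_mx_block.
Qed.

(** Since [swap2] squares to the identity, the Schur correction cancels the summand [1%:M] of the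
    corner block. *)
Lemma base_coefs u e (B := shuffle (base u e)) :
  [/\ drsubmx B = 1%:M, al_of B = u%:M + e *: swap2, ka_of B = 1%:M,
      v_of B = swap2 & w_of B = swap2].
Proof.
rewrite /B shuffle_base /al_of /ka_of /v_of /w_of.
rewrite block_mxKdr block_mxKul block_mxKur block_mxKdl invmx1 !mulmx1 mul1mx.
rewrite mul_row_col mul0mx addr0 swap2_sqr addrC addKr.
by rewrite [1%:M]scalar_mx_block block_mxKul col_mxKu row_mxKl.
Qed.

Section Continuity.
Variable A : filling R S.
Hypothesis uG : drsubmx (shuffle A) \in unitmx.

Let shuffle_cvg : mx_cvg (nbhs A) shuffle (shuffle A).
Proof.
have fc := @cvg_fill_zero R N S A.
apply: mx_cvg_col; last apply: mx_cvg_col.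
- exact: (@mx_cvg_usub _ _ _ 2 m N _ _ (@mx_cvg_dsub _ _ _ 2 (2 + m) N _ _ fc)).
- exact: (@mx_cvg_usub _ _ _ 2 (2 + m) N _ _ fc).
- exact: (@mx_cvg_dsub _ _ _ 2 m N _ _ (@mx_cvg_dsub _ _ _ 2 (2 + m) N _ _ fc)).
Qed.

Let inv_cvg : mx_cvg (nbhs A) (fun B => invmx (drsubmx (shuffle B)))
  (invmx (drsubmx (shuffle A))).
Proof. by apply: mx_cvg_inv => //; apply: mx_cvg_rsub; exact: mx_cvg_dsub. Qed.

Lemma near_specified_unitmx : \forall B \near A, drsubmx (shuffle B) \in unitmx.
Proof.
have G_cvg : mx_cvg (nbhs A) (fun B => drsubmx (shuffle B)) (drsubmx (shuffle A)).
  by apply: mx_cvg_rsub; exact: mx_cvg_dsub.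
exact: near_unitmx uG G_cvg.
Qed.

Lemma mx_cvg_al : mx_cvg (nbhs A) (al_of \o shuffle) (al_of (shuffle A)).
Proof.
apply: mx_cvgB; first by apply: mx_cvg_lsub; exact: mx_cvg_usub.
apply: mx_cvgM; last by apply: mx_cvg_lsub; exact: mx_cvg_dsub.
by apply: mx_cvgM => //; apply: mx_cvg_rsub; exact: mx_cvg_usub.
Qed.

Lemma mx_cvg_ka : mx_cvg (nbhs A) (ka_of \o shuffle) (ka_of (shuffle A)).
Proof. by apply: mx_cvg_lsub; exact: mx_cvg_usub. Qed.

Lemma mx_cvg_v : mx_cvg (nbhs A) (v_of \o shuffle) (v_of (shuffle A)).
Proof.
by apply: mx_cvg_usub; apply: mx_cvgM => //; apply: mx_cvg_lsub;
   exact: mx_cvg_dsub.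
Qed.

Lemma mx_cvg_w : mx_cvg (nbhs A) (w_of \o shuffle) (w_of (shuffle A)).
Proof.
by apply: mx_cvg_lsub; apply: mx_cvgM => //; apply: mx_cvg_rsub;
   exact: mx_cvg_usub.
Qed.

End Continuity.

Section NearBase.
Variables u e : R.
Local Notation A := (base u e).

Lemma base_unitmx : drsubmx (shuffle A) \in unitmx.
Proof. by case: (base_coefs u e) => -> *; exact: unitmx1. Qed.

Lemma cvg_base_quad t :
  (fun B => elim_quad (al_of (shuffle B)) (ka_of (shuffle B)) (v_of (shuffle B))
              (w_of (shuffle B)) t) @ A --> - e * (t ^+ 2 - e * t + u).
Proof.
have uG := base_unitmx.
rewrite (_ : - e * _ = elim_quad (al_of (shuffle A)) (ka_of (shuffle A))
    (v_of (shuffle A)) (w_of (shuffle A)) t).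
  exact: cvg_elim_quad (mx_cvg_al uG) (mx_cvg_ka uG) (mx_cvg_v uG) (mx_cvg_w uG)
    (cvg_cst t).
case: (base_coefs u e) => _ -> -> -> ->.
by rewrite /elim_quad /elim_slope /elim_const !mxE /=; ring.
Qed.

Lemma cvg_base_disc :
  (fun B => elim_disc (al_of (shuffle B)) (ka_of (shuffle B)) (v_of (shuffle B))
              (w_of (shuffle B))) @ A --> 4 * e ^+ 2 * (4 * u - e ^+ 2).
Proof.
have uG := base_unitmx.
rewrite (_ : 4 * _ * _ = elim_disc (al_of (shuffle A)) (ka_of (shuffle A))
    (v_of (shuffle A)) (w_of (shuffle A))).
  exact: cvg_elim_disc (mx_cvg_al uG) (mx_cvg_ka uG) (mx_cvg_v uG) (mx_cvg_w uG).
case: (base_coefs u e) => _ -> -> -> ->.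
by rewrite /elim_disc /elim_quad /elim_slope /elim_const !mxE /=; ring.
Qed.

Lemma cvg_base_slope t :
  (fun B => elim_slope (al_of (shuffle B)) (ka_of (shuffle B)) (v_of (shuffle B))
              (w_of (shuffle B)) 0 t) @ A --> t.
Proof.
have uG := base_unitmx.
rewrite [X in _ --> X](_ : t = elim_slope (al_of (shuffle A)) (ka_of (shuffle A))
    (v_of (shuffle A)) (w_of (shuffle A)) 0 t).
  exact: cvg_elim_slope (mx_cvg_al uG) (mx_cvg_ka uG) (mx_cvg_v uG) (mx_cvg_w uG)
    (cvg_cst t) 0.
case: (base_coefs u e) => _ -> -> -> ->.
by rewrite /elim_slope !mxE /=; ring.
Qed.

Lemma cvg_base_row i t :
  (fun B => ka_of (shuffle B) i 0 * t + v_of (shuffle B) i 0) @ A -->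
  (1%:M : 'M[R]_2) i 0 * t + swap2 i 0.
Proof.
have uG := base_unitmx.
have := @mx_cvg_ka _ uG i 0; have := @mx_cvg_v _ uG i 0.
case: (base_coefs u e) => _ _ -> -> _ vc kc.
exact: (cvgD (cvgM kc (cvg_cst t)) vc).
Qed.

End NearBase.

(** An affine function is bounded below by its smaller endpoint value. Positivity over an interval
    thus reduces to two conditions, each stable under small changes of the filling. *)
Lemma affine_gt0 (a b lo hi t : R) : t \in `[lo, hi] ->
  0 < a * lo + b -> 0 < a * hi + b -> 0 < a * t + b.
Proof.
rewrite in_itv /= => /andP[lot thi] hlo hhi; have [a0|a0] := leP 0 a.
  by apply: lt_le_trans hlo _; rewrite lerD2r ler_wpM2l.
by apply: lt_le_trans hhi _; rewrite lerD2r ler_wnM2l // ltW.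
Qed.

(** * The two typical ranks, and the exclusion of all others *)

Lemma typical_rank_corank2 : typical_ranks R S (2 + m)%N.
Proof.
(* Here the limit of [elim_quad t] is [-3 (t - 1) (t - 2)], which changes sign
   between 1/2 and 3/2. *)
apply: (@typical_rank_near _ _ _ (base 2 3)).
have uG := near_specified_unitmx (base_unitmx 2 3).
have qlo : \forall B \near base 2 3, elim_quad (al_of (shuffle B))
    (ka_of (shuffle B)) (v_of (shuffle B)) (w_of (shuffle B)) (1 / 2) < 0.
  by apply: (cvgr_lt _ (@cvg_base_quad 2 3 (1 / 2))); lra.
have qhi : \forall B \near base 2 3, 0 < elim_quad (al_of (shuffle B))
    (ka_of (shuffle B)) (v_of (shuffle B)) (w_of (shuffle B)) (3 / 2).
  by apply: (cvgr_gt _ (@cvg_base_quad 2 3 (3 / 2))); lra.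
have slope t : 0 < t -> \forall B \near base 2 3, 0 < elim_slope (al_of (shuffle B))
    (ka_of (shuffle B)) (v_of (shuffle B)) (w_of (shuffle B)) 0 t.
  by move=> t0; apply: (cvgr_gt _ (@cvg_base_slope 2 3 t)).
have row i t : 0 < t -> \forall B \near base 2 3,
    0 < ka_of (shuffle B) i 0 * t + v_of (shuffle B) i 0.
  move=> t0; apply: (cvgr_gt _ (@cvg_base_row 2 3 i t)); rewrite !mxE.
  by case: i => -[|[|//]] ? /=; lra.
have lo0 : (0 : R) < 1 / 2 by lra.
have hi0 : (0 : R) < 3 / 2 by lra.
have slo := slope _ lo0; have shi := slope _ hi0.
have r0lo := row 0 _ lo0; have r0hi := row 0 _ hi0.
have r1lo := row 1 _ lo0; have r1hi := row 1 _ hi0.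
near=> B; have uB : drsubmx (shuffle B) \in unitmx by near: B.
split; last by move=> M; exact: rank_completion_ge.
have [|||x [y res0]] := @residual_solvable R (al_of (shuffle B)) (ka_of (shuffle B))
  (v_of (shuffle B)) (w_of (shuffle B)) (1 / 2) (3 / 2).
- lra.
- by apply/andP; split; near: B.
- move=> t tin; split; apply: lt0r_neq0; apply: affine_gt0 tin _ _; by near: B.
exists (fill B + free_diag x y); first by apply/completion_free_diagP; exists x, y.
by rewrite rank_fill // res0 mxrank0 addn0.
Unshelve. all: by end_near. Qed.

Lemma typical_rank_corank1 : typical_ranks R S (3 + m)%N.
Proof.
(* Here the limit of [elim_quad t] is [- (t ^+ 2 - t + 1)], which has no real root, and that of
   [elim_disc] is 12. *)
apply: (@typical_rank_near _ _ _ (base 1 1)).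
have uG := near_specified_unitmx (base_unitmx 1 1).
have disc : \forall B \near base 1 1, 0 < elim_disc (al_of (shuffle B))
    (ka_of (shuffle B)) (v_of (shuffle B)) (w_of (shuffle B)).
  by apply: (cvgr_gt _ (@cvg_base_disc 1 1)); lra.
have row i : \forall B \near base 1 1,
    0 < ka_of (shuffle B) i 0 * 1 + v_of (shuffle B) i 0.
  apply: (cvgr_gt _ (@cvg_base_row 1 1 i 1)); rewrite !mxE.
  by case: i => -[|[|//]] ? /=; lra.
have row0 := row 0; have row1 := row 1.
near=> B; have uB : drsubmx (shuffle B) \in unitmx by near: B.
have res_neq0 : forall x y, bilinear_residual (al_of (shuffle B))
    (ka_of (shuffle B)) (v_of (shuffle B)) (w_of (shuffle B)) x y != 0.
  by apply: residual_neq0; near: B.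
split; last first.
  move=> M /completion_free_diagP[x [y ->]]; rewrite rank_fill //.
  by rewrite addnAC leq_add2r (@leq_add 2 1 2) // lt0n mxrank_eq0.
have [||x [y rank1]] := @residual_col0_solvable R (al_of (shuffle B))
  (ka_of (shuffle B)) (v_of (shuffle B)) (w_of (shuffle B)).
- by apply: lt0r_neq0; rewrite -[ka_of _ _ _]mulr1; near: B.
- by apply: lt0r_neq0; rewrite -[ka_of _ _ _]mulr1; near: B.
exists (fill B + free_diag x y); first by apply/completion_free_diagP; exists x, y.
rewrite rank_fill // addnAC; congr (_ + _)%N; congr (2 + _)%N; apply/eqP.
by rewrite eqn_leq rank1 lt0n mxrank_eq0 res_neq0.
Unshelve. all: by end_near. Qed.

(** The specified block of [base 0 0] is the identity, so a small move in that direction stays in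
    the open set and makes the block invertible. *)
Lemma typical_rank_ge r : typical_ranks R S r -> (2 + m <= r)%N.
Proof.
move=> [U [Uo [A UA] Ur]].
have [t Ut uG] := exists_near_unitmx (drsubmx (shuffle A))
  (near_line (base 0 0) (open_nbhs_nbhs (conj Uo UA))).
have [[M AM <-] _] := Ur _ Ut; apply: rank_completion_ge AM.
rewrite /shuffle fill_zeroDZ swap_rowsDZ drsubmxDZ -/(shuffle A) -/(shuffle _).
by case: (base_coefs 0 0) => G1 _ _ _ _; rewrite G1 scalemx1.
Qed.

(** A small multiple of the identity makes the minor without first row and column invertible; the
    free corner entry then brings the rank down to the size of that minor. *)
Lemma typical_rank_le r : typical_ranks R S r -> (r <= 3 + m)%N.
Proof.
move=> [U [Uo [A UA] Ur]].
have [t Ut uG] := exists_near_unitmx (@drsubmx R 1 (3 + m) 1 (3 + m) (fill A))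
  (near_line (@restrict_mx R N S 1%:M) (open_nbhs_nbhs (conj Uo UA))).
(* On specified positions [C] is the perturbed filling; the four free entries are chosen equal to
   [t]. *)
pose C : 'M[R]_(1 + (3 + m)) := fill A + t%:M.
have uC : drsubmx C \in unitmx.
  rewrite /C -scalemx1 (@drsubmxDZ R 1 (3 + m) 1 (3 + m)).
  by rewrite (@scalar_mx_block _ 1 (3 + m)) block_mxKdr scalemx1.
(* The corner is the value at which the 1 x 1 Schur complement vanishes. *)
pose D : 'M[R]_(1 + (3 + m)) :=
  block_mx (ursubmx C *m invmx (drsubmx C) *m dlsubmx C) (ursubmx C) (dlsubmx C)
    (drsubmx C).
have rankD : \rank D = (3 + m)%N.
  by rewrite rank_block_mx_schur // subrr mxrank0 addn0.
have [_ /(_ D)] := Ur _ Ut; rewrite rankD; apply.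
apply/completionP => i j ijS.
have -> : fill (A + t *: @restrict_mx R N S 1%:M) i j = C i j.
  rewrite fill_zeroDZ mxE [X in _ + X]mxE fill_restrict // /C [RHS]mxE.
  by congr (_ + _); rewrite !mxE mulr_natr.
have -> : C = block_mx (ulsubmx C) (ursubmx C) (dlsubmx C) (drsubmx C).
  by rewrite submxK.
have ij0 : (i, j) != (0, 0).
  by apply: contraTneq ijS => ->; rewrite mem_specified eqxx.
rewrite /D !mxE; case: splitP => k ik; rewrite !mxE; case: splitP => l jl //.
by case/eqP: ij0; congr (_, _); apply: val_inj; rewrite /= ?ik ?jl ord1.
Qed.

End MissingDiagonal.

Theorem proposition3p9 (R : realType) (N : nat) (hN : (4 <= N)%N) :
  typical_coranks R (~: diag_positions N 4)%SET = [set 1%N; 2%N].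
Proof.
case: N hN => [|[|[|[|m]]]] // _; apply/seteqP; split=> [_ [r r_typ <-]|r].
  have := @typical_rank_ge R m r r_typ; have := @typical_rank_le R m r r_typ.
  move=> r_le r_ge; have [->|->] : r = (3 + m)%N \/ r = (2 + m)%N by lia.
    by left; apply: (_ : _ = 1%N); lia.
  by right; apply: (_ : _ = 2%N); lia.
by case=> ->; [exists (3 + m)%N|exists (2 + m)%N];
  [exact: typical_rank_corank1|lia|exact: typical_rank_corank2|lia].
Qed.
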